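(* Let $G$ be a graph and let $H(G)$ be its Hamming expansion. If $G$ is ELC-preserved, then $H(G)$ is ELC-preserved.
   Context: All graphs are finite, simple and undirected. For a graph $G=(V,E)$ and $v\in V$, $N_v$ is the set of vertices adjacent to $v$. Local complementation (LC) on $v$ transforms $G$ into $G*v$ by replacing the induced subgraph of $G$ on $N_v$ by its complement. For an edge $\{u,v\}\in E$, edge local complementation (ELC) on $\{u,v\}$ transforms $G$ into $G^{(u,v)}=G*u*v*u=G*v*u*v$ (operations applied from left to right). $G$ is ELC-preserved if for every edge $\{u,v\}\in E$, $G^{(u,v)}$ is isomorphic to $G$. Hamming expansion: let $G=(V,E)$ with $V=\{v_0,\dots,v_{k-1}\}$. $H(G)$ is the graph on the $7k$ vertices $w_0,\dots,w_{7k-1}$ constructed as follows. For each $0\le i<k$, the vertex $v_i$ is replaced by the subgraph $h_i$ with vertices $\{w_{7i},\dots,w_{7i+6}\}$ and edges $\{w_{7i},w_{7i+3}\}$, $\{w_{7i},w_{7i+4}\}$, $\{w_{7i+1},w_{7i+3}\}$, $\{w_{7i+1},w_{7i+5}\}$, $\{w_{7i+2},w_{7i+4}\}$, $\{w_{7i+2},w_{7i+5}\}$, $\{w_{7i+3},w_{7i+6}\}$, $\{w_{7i+4},w_{7i+6}\}$, $\{w_{7i+5},w_{7i+6}\}$. If $\{v_i,v_j\}\in E$, each of $w_{7i},w_{7i+1},w_{7i+2}$ is joined to all of $w_{7j},w_{7j+1},w_{7j+2}$. There are no other edges. *)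

(* Defs.v *)
From mathcomp Require Import all_boot.

Set Implicit Arguments.
Unset Strict Implicit.
Unset Printing Implicit Defensive.

Record sgraph := SGraph {
  vertex :> finType;
  adj : rel vertex;
  adj_sym : symmetric adj;
  adj_irrefl : irreflexive adj
}.

Definition isomorphic (G H : sgraph) : Prop :=
  exists f : G -> H,
    bijective f /\ forall x y : G, adj (f x) (f y) = adj x y.

Definition lc_rel (G : sgraph) (v : G) : rel G :=
  fun x y => adj x y (+) [&& x != y, adj v x & adj v y].

Lemma lc_sym (G : sgraph) (v : G) : symmetric (lc_rel v).
Proof.
by move=> x y; rewrite /lc_rel adj_sym eq_sym (andbC (adj v x)).
Qed.

Lemma lc_irrefl (G : sgraph) (v : G) : irreflexive (lc_rel v).
Proof. by move=> x; rewrite /lc_rel adj_irrefl eqxx. Qed.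

Definition lc (G : sgraph) (v : G) : sgraph :=
  SGraph (@lc_sym G v) (@lc_irrefl G v).

(* G * u * v * u, where the operations are applied from left to right; all the
   graphs involved have the vertex type of G, up to conversion. *)
Definition elc (G : sgraph) (u v : G) : sgraph :=
  @lc (@lc (@lc G u) v) u.

(* G * u * v * u = G * v * u * v on an edge, so [elc] does not depend on the
   order of the endpoints. *)
Lemma elcC (G : sgraph) (u v : G) :
  adj u v -> @adj (elc u v) =2 @adj (elc v u).
Proof.
move=> uv; have vu : adj v u by rewrite adj_sym.
have uv' : u != v by apply: contraTneq uv => ->; rewrite adj_irrefl.
change (forall x y : G, @adj (elc u v) x y = @adj (elc v u) x y) => x y.
rewrite /elc /lc /=; do 3!rewrite /lc_rel /=.
rewrite !adj_irrefl !(eq_sym v u) uv' uv vu /=.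
have [->|xy] := eqVneq x y; first by rewrite !addbF.
have uu := adj_irrefl u; have vv := adj_irrefl v.
have [eux|ux] := eqVneq u x; have [euy|uy] := eqVneq u y;
have [evx|vx] := eqVneq v x; have [evy|vy] := eqVneq v y; subst;
  rewrite ?eqxx // in uv' xy *;
  rewrite /= ?uu ?vv ?uv ?vu ?(adj_sym _ u) ?(adj_sym _ v) ?uu ?vv ?uv ?vu /=;
  by do ?case: (adj _ _).
Qed.

Definition elc_preserved (G : sgraph) : Prop :=
  forall u v : G, adj u v -> isomorphic (elc u v) G.

Definition hblock_edges : seq (nat * nat) :=
  [:: (0, 3); (0, 4); (1, 3); (1, 5); (2, 4); (2, 5); (3, 6); (4, 6); (5, 6)].

Definition hblock_rel : rel 'I_7 := fun a b =>
  ((a : nat, b : nat) \in hblock_edges) || ((b : nat, a : nat) \in hblock_edges).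

(* For G on v_0, ..., v_(k-1), the pair (v_i, a) stands for the vertex
   w_(7 i + a) of the expansion. *)
Definition hamming_rel (G : sgraph) : rel (G * 'I_7) := fun x y =>
  ((x.1 == y.1) && hblock_rel x.2 y.2)
  || [&& adj x.1 y.1, x.2 < 3 & y.2 < 3].

Lemma hamming_sym (G : sgraph) : symmetric (@hamming_rel G).
Proof.
by move=> x y; rewrite /hamming_rel /hblock_rel eq_sym orbC adj_sym
  (andbC (x.2 < 3)) orbC (orbC (_ \in _)).
Qed.

Lemma hamming_irrefl (G : sgraph) : irreflexive (@hamming_rel G).
Proof.
by case=> x [[|[|[|[|[|[|[|a]]]]]]] lt_a] //;
  rewrite /hamming_rel /= adj_irrefl eqxx.
Qed.

Definition hamming_expansion (G : sgraph) : sgraph :=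
  SGraph (@hamming_sym G) (@hamming_irrefl G).

(* Main.v *)
Require Import Defs.
From mathcomp Require Import all_boot.

Set Implicit Arguments.
Unset Strict Implicit.
Unset Printing Implicit Defensive.

(** Add to a block [h_i] one vertex [star] joined to its three outer vertices
    0, 1, 2, standing for the rest of the graph.  The result is the cube graph,
    with colour classes 0, 1, 2, 6 and 3, 4, 5, [star].  The cube is
    ELC-preserved (it is the graph of the extended Hamming code), and since its
    automorphisms act transitively on the vertices, the isomorphism can be
    chosen to fix [star].  So for every edge of the cube some permutation of the
    seven vertices of the block undoes the ELC ([cube_elc_preserved_fix]).

    Moreover ELC on an edge [uv] adds to the adjacency matrix over GF(2) the
    matrix A B^T + B A^T, where A and B are the indicator vectors of the closed
    neighbourhoods of [u] and [v] ([elcE]).  In [H(G)], the closed neighbourhood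
    of a vertex of block [i] is a closed neighbourhood of the cube inside that
    block, and a neighbourhood of [i] in G outside it ([hamming_cadj]).  Hence
    the matrix identities that have to be proved for [H(G)] split, block by
    block, into identities for G and identities for the cube.

    For an edge inside a block, the cube identities for the same edge show that
    ELC gives back [H(G)] ([elc_within_block]).  For an edge between the blocks
    of [i] and [j], use in each of these two blocks the cube edge from the
    endpoint to [star]: ELC then gives [H] of the ELC of G on [ij]
    ([elc_between_blocks]).  Both isomorphisms only move vertices inside the
    blocks of the endpoints.  If G is ELC-preserved, the second graph is
    isomorphic to [H(G)] too, because [H] respects isomorphism. *)

(** * Isomorphism and edge local complementation *)

Lemma isomorphic_sym (G H : sgraph) : isomorphic G H -> isomorphic H G.
Proof.
case=> f [[g fK gK] fE]; exists g; split; first by exists f.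
by move=> x y; rewrite -fE !gK.
Qed.

Lemma isomorphic_trans (G H K : sgraph) :
  isomorphic G H -> isomorphic H K -> isomorphic G K.
Proof.
case=> f [bf fE] [g [bg gE]]; exists (g \o f); split; first exact: bij_comp.
by move=> x y; rewrite gE fE.
Qed.

Definition cadj (G : sgraph) (v : G) : pred G := fun x => (x == v) || adj v x.

(** With closed neighbourhoods instead of open ones, the usual description of
    ELC (complement between the neighbourhoods, then exchange [u] and [v])
    becomes a single formula that needs no exception for the endpoints: in
    row [u], the added terms replace the neighbours of [u] by those of [v]. *)
Lemma elcE (G : sgraph) (u v x y : G) : adj u v ->
  @adj (elc u v) x y =
  adj x y (+) (cadj u x && cadj v y) (+) (cadj u y && cadj v x).
Proof.
move=> uv; have vu : adj v u by rewrite adj_sym.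
have uv' : u != v by apply: contraTneq uv => ->; rewrite adj_irrefl.
have uu := adj_irrefl u; have vv := adj_irrefl v.
rewrite /elc /lc /=; do 3!rewrite /lc_rel /=.
rewrite /cadj !adj_irrefl !(eq_sym v u) uv' uv vu /=.
have [->|xy] := eqVneq x y.
  by rewrite adj_irrefl !addbF addFb addbb.
have [eux|ux] := eqVneq u x; have [euy|uy] := eqVneq u y;
have [evx|vx] := eqVneq v x; have [evy|vy] := eqVneq v y; subst;
  rewrite ?eqxx // in uv' xy *;
  rewrite ?(eq_sym _ u) ?(eq_sym _ v) ?(negbTE uv') ?(negbTE ux) ?(negbTE uy)
    ?(negbTE vx) ?(negbTE vy) /= ?uu ?vv ?uv ?vu ?(adj_sym _ u)
    ?(adj_sym _ v) ?uu ?vv ?uv ?vu /=;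
  by do ?case: (adj _ _).
Qed.

(** * The cube *)

Definition cube_rel : rel (option 'I_7) := fun p q =>
  match p, q with
  | Some a, Some b => hblock_rel a b
  | Some a, None | None, Some a => a < 3
  | None, None => false
  end.

Lemma cube_sym : symmetric cube_rel.
Proof. by case=> [a|] [b|] //=; rewrite /hblock_rel orbC. Qed.

Lemma cube_irrefl : irreflexive cube_rel.
Proof. by case=> [[[|[|[|[|[|[|[|a]]]]]]] lt_a]|]. Qed.

Definition cube : sgraph := SGraph cube_sym cube_irrefl.

Definition star : cube := None.
Definition block_vertex (a : 'I_7) : cube := Some a.

Local Notation w k := (@Ordinal 7 k isT).

Definition swap (a b c : 'I_7) : 'I_7 :=
  if c == a then b else if c == b then a else c.

Lemma swap_inj a b : injective (swap a b).
Proof.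
apply: inv_inj => c; rewrite /swap.
have [->|ca] := eqVneq c a; first by rewrite eqxx; case: eqVneq.
by have [->|cb] := eqVneq c b; rewrite ?eqxx ?(negbTE ca) ?(negbTE cb).
Qed.

(** Extending [s] by [omap] makes it fix [star], so that it can act inside one
    block of an expansion without touching the rest of the graph. *)
Definition cube_elc_fix (s : 'I_7 -> 'I_7) (x y : cube) :=
  injective s /\
  forall p q : cube,
    @adj (elc x y) (omap s p : cube) (omap s q : cube) = adj p q.

(** The edges are oriented so that [y] lies in the colour class of [star]; by
    [elcC] this loses nothing, and it leaves twelve edges to check. *)
Lemma cube_elc_fix_oriented (x y : cube) :
  adj x y -> (if y is Some b then 3 <= b < 6 else true) ->
  exists s, cube_elc_fix s x y.
Proof.
(* In the cube, the other neighbours of [a] are matched with the other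
   neighbours [r], [t] of [b].  Besides exchanging [a] and [b], ELC complements
   this two-edge matching, which exchanging [r] and [t] repairs. *)
pose inner a b r t := swap r t \o swap a b.
(* The same relabelling for an edge from [a] to [star] exchanges these two, and
   the other neighbours [p], [r] of [star].  To fix [star], it is preceded by
   the reflection of the cube that exchanges the ends of each edge parallel to
   this one; [pq], [rt] and [mn] are the other parallel edges. *)
pose outer p q r t m n := swap m n \o swap p r \o swap r t \o swap p q.
have inner_inj a b r t : injective (inner a b r t).
  by do !(apply: swap_inj || apply: inj_comp).
have outer_inj p q r t m n : injective (outer p q r t m n).
  by do !(apply: swap_inj || apply: inj_comp).
case: x => [[[|[|[|[|[|[|[|a]]]]]]] lt_a]|] //;
  case: y => [[[|[|[|[|[|[|[|b]]]]]]] lt_b]|] // xy _;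
  [ exists (inner (w 0) (w 3) (w 1) (w 6))
  | exists (inner (w 0) (w 4) (w 2) (w 6))
  | exists (outer (w 1) (w 3) (w 2) (w 4) (w 5) (w 6))
  | exists (inner (w 1) (w 3) (w 0) (w 6))
  | exists (inner (w 1) (w 5) (w 2) (w 6))
  | exists (outer (w 0) (w 3) (w 2) (w 5) (w 4) (w 6))
  | exists (inner (w 2) (w 4) (w 0) (w 6))
  | exists (inner (w 2) (w 5) (w 1) (w 6))
  | exists (outer (w 0) (w 4) (w 1) (w 5) (w 3) (w 6))
  | exists (inner (w 6) (w 3) (w 0) (w 1))
  | exists (inner (w 6) (w 4) (w 0) (w 2))
  | exists (inner (w 6) (w 5) (w 1) (w 2)) ];
  (split; first by [apply: inner_inj | apply: outer_inj]);
  move=> p q; rewrite elcE // /inner /outer;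
  case: p => [[[|[|[|[|[|[|[|?]]]]]]] ?]|] //;
  case: q => [[[|[|[|[|[|[|[|?]]]]]]] ?]|] //;
  by vm_compute.
Qed.

Lemma cube_elc_preserved_fix (x y : cube) :
  adj x y -> exists s, cube_elc_fix s x y.
Proof.
move=> xy; have yx : adj y x by rewrite adj_sym.
have [|y_class] := boolP (if y is Some b then 3 <= b < 6 else true).
  exact: cube_elc_fix_oriented xy.
case: (cube_elc_fix_oriented yx) => [|s [s_inj sE]].
  case: x y xy y_class {yx} => [[[|[|[|[|[|[|[|?]]]]]]] ?]|] //;
    by case=> [[[|[|[|[|[|[|[|?]]]]]]] ?]|].
exists s; split=> // p q; rewrite -sE.
exact: elcC xy _ _.
Qed.

Lemma cube_elc_fix_block s (x y : cube) c d :
  adj x y -> cube_elc_fix s x y ->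
  adj (block_vertex c) (block_vertex d) =
  adj (block_vertex (s c)) (block_vertex (s d))
  (+) (cadj x (block_vertex (s c)) && cadj y (block_vertex (s d)))
  (+) (cadj x (block_vertex (s d)) && cadj y (block_vertex (s c))).
Proof.
by move=> xy [_ sE]; rewrite -(sE (block_vertex c) (block_vertex d)) elcE.
Qed.

Lemma cube_elc_fix_star s (x y : cube) c :
  adj x y -> cube_elc_fix s x y ->
  adj star (block_vertex c) =
  adj star (block_vertex (s c))
  (+) (cadj x star && cadj y (block_vertex (s c)))
  (+) (cadj x (block_vertex (s c)) && cadj y star).
Proof.
by move=> xy [_ sE]; rewrite -(sE star (block_vertex c)) elcE.
Qed.

Lemma cadj_star (a : 'I_7) :
  cadj (block_vertex a) star = adj star (block_vertex a).
Proof. by rewrite /cadj adj_sym. Qed.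

Lemma star_cadj (a : 'I_7) :
  cadj star (block_vertex a) = adj star (block_vertex a).
Proof. by []. Qed.

(** ELC on the edge from [a] to [star] gives to [star] the former neighbours of
    [a], so [s] carries the outer vertices of the block to the closed
    neighbourhood of [a].  The added terms in the second identity are those that
    an edge from [a] to an outer vertex of another block produces in the block
    of [a], because that other vertex is joined to all outer vertices. *)
Lemma star_pivot (a : 'I_7) :
  adj star (block_vertex a) ->
  exists2 s : 'I_7 -> 'I_7, injective s &
    (forall c, adj star (block_vertex c) =
       cadj (block_vertex a) (block_vertex (s c))) /\
    (forall c d, adj (block_vertex c) (block_vertex d) =
       adj (block_vertex (s c)) (block_vertex (s d))
       (+) (cadj (block_vertex a) (block_vertex (s c)) &&
            adj star (block_vertex (s d)))
       (+) (cadj (block_vertex a) (block_vertex (s d)) &&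
            adj star (block_vertex (s c)))).
Proof.
move=> a_out; have a_star : adj (block_vertex a) star by rewrite adj_sym.
have [s s_fix] := cube_elc_preserved_fix a_star; exists s; first by case: s_fix.
split=> [c | c d]; last exact: cube_elc_fix_block a_star s_fix.
rewrite (cube_elc_fix_star _ a_star s_fix) star_cadj cadj_star a_out /=.
by rewrite addbb andbT.
Qed.

(** * Edge local complementation in a Hamming expansion *)

Section Expansion.

Variable G : sgraph.
Local Notation H := (hamming_expansion G).
Local Notation hv i a := ((i, a) : hamming_expansion _).

Lemma hamming_adj (K : sgraph) (k l : K) (c d : 'I_7) :
  adj (hv k c) (hv l d) =
  if k == l then adj (block_vertex c) (block_vertex d)
  else [&& adj k l, adj star (block_vertex c) & adj star (block_vertex d)].
Proof.
rewrite /= /hamming_rel /=; case: eqVneq => [->|//].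
by rewrite adj_irrefl orbF.
Qed.

(** Being outer is written as adjacency to [star], so that the closed
    neighbourhood of a vertex of [H(G)] is expressed by the cube and G only. *)
Lemma hamming_cadj (i k : G) (a c : 'I_7) :
  cadj (hv i a) (hv k c) =
  if k == i then cadj (block_vertex a) (block_vertex c)
  else [&& adj i k, adj star (block_vertex a) & adj star (block_vertex c)].
Proof.
rewrite /cadj hamming_adj xpair_eqE (eq_sym i).
by case: eqVneq.
Qed.

Lemma blockwise_bij (s : G -> 'I_7 -> 'I_7) :
  (forall k, injective (s k)) ->
  bijective (fun x : G * 'I_7 => (x.1, s x.1 x.2)).
Proof.
move=> s_inj; apply: injF_bij => -[k c] [l d] /= [-> /s_inj ->] //.
Qed.

(** The whole outside of the block of [i] behaves like [star]: a vertex outside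
    is joined to all outer vertices of the block or to none.  So the identities
    of the cube for [star] settle the adjacencies across the boundary, and
    outside the two added terms are equal. *)
Lemma elc_within_block (i : G) (a b : 'I_7) :
  adj (hv i a) (hv i b) -> isomorphic H (@elc H (i, a) (i, b)).
Proof.
move=> uv; have ab : adj (block_vertex a) (block_vertex b).
  by rewrite hamming_adj eqxx in uv.
have [s s_fix] := cube_elc_preserved_fix ab; have [s_inj _] := s_fix.
pose t k := if k == i then s else id.
exists (fun x => (x.1, t x.1 x.2)); split.
  by apply: blockwise_bij => k; rewrite /t; case: ifP => _; [|apply: inj_id].
suff tE k c l d :
    @adj (@elc H (i, a) (i, b)) (k, t k c) (l, t l d) = adj (hv k c) (hv l d).
  by move=> [k c] [l d]; apply: tE.
rewrite elcE // !hamming_cadj !hamming_adj /t.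
have [k_i|ki] := eqVneq k i; have [l_i|li] := eqVneq l i;
  try subst k; try subst l; rewrite ?eqxx ?(eq_sym i) ?(negbTE ki) ?(negbTE li).
- exact/esym/(cube_elc_fix_block c d ab s_fix).
- rewrite (cube_elc_fix_star c ab s_fix) !cadj_star.
  by do ?case: (cadj _ _); do ?case: (adj _ _).
- rewrite (cube_elc_fix_star d ab s_fix) !cadj_star (adj_sym k i).
  by do ?case: (cadj _ _); do ?case: (adj _ _).
- case: eqVneq => _; by do ?case: (adj _ _).
Qed.

(** The two blocks need not be exchanged.  ELC in G gives to [i] the neighbours
    of [j]; ELC in [H(G)] joins the closed neighbourhood of [a] in the block of
    [i], which is where [star_pivot] puts the new outer vertices, to the
    vertices that were joined to the outer vertices of the block of [j]. *)
Lemma elc_between_blocks (i j : G) (a b : 'I_7) :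
  i != j -> adj (hv i a) (hv j b) ->
  isomorphic (hamming_expansion (elc i j)) (@elc H (i, a) (j, b)).
Proof.
move=> ij uv; have := uv; rewrite hamming_adj (negbTE ij) => /and3P [eij ea eb].
have ji : j != i by rewrite eq_sym.
have [s s_inj [s_star sE]] := star_pivot ea.
have [t t_inj [t_star tE]] := star_pivot eb.
pose r k := if k == i then s else if k == j then t else id.
exists (fun x => (x.1, r x.1 x.2)); split.
  apply: blockwise_bij => k; rewrite /r.
  by do 2?case: ifP => _ //; apply: inj_id.
suff rE k c l d :
    @adj (@elc H (i, a) (j, b)) (k, r k c) (l, r l d) =
    @adj (hamming_expansion (elc i j)) (k, c) (l, d).
  by move=> [k c] [l d]; apply: rE.
rewrite elcE // !hamming_cadj !hamming_adj elcE //.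
rewrite ea eb /r.
have [k_i|ki] := eqVneq k i; [|have [k_j|kj] := eqVneq k j];
  (have [l_i|li] := eqVneq l i; [|have [l_j|lj] := eqVneq l j]);
  try subst k; try subst l;
  rewrite ?eqxx ?(eq_sym i) ?(eq_sym j) ?(negbTE ki) ?(negbTE kj)
    ?(negbTE li) ?(negbTE lj) ?(negbTE ji) ?(negbTE ij).
(* Once the closed neighbourhoods of [a] and [b] are written back as the sets of
   outer vertices before relabelling, the cases left are identities of bits,
   except inside the blocks of [i] and [j], where the cube identities enter. *)
all: rewrite ?(adj_sym j i) ?eij ?(adj_sym k i) ?(adj_sym k j).
all: rewrite -?s_star -?t_star /cadj ?eqxx.
all: rewrite ?(negbTE ki) ?(negbTE kj) ?(negbTE li) ?(negbTE lj) ?(negbTE ij).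
all: rewrite ?(negbTE ji) ?(adj_sym j i) ?eij.
all: try by do ?case: (adj _ _).
- by rewrite [in RHS](sE c d) -!s_star.
- rewrite [in RHS](tE c d) -!t_star.
  by rewrite addbAC /= !(andbC (adj star (block_vertex (t _)))).
- by case: eqVneq => [->|_]; do ?case: (adj _ _).
Qed.

End Expansion.

Lemma isomorphic_hamming (G K : sgraph) :
  isomorphic G K -> isomorphic (hamming_expansion G) (hamming_expansion K).
Proof.
case=> f [[g fK gK] fE].
exists (fun x => (f x.1, x.2)); split.
  by exists (fun x => (g x.1, x.2)) => -[k c] /=; rewrite ?fK ?gK.
by move=> x y; rewrite /= /hamming_rel /= fE (can_eq fK).
Qed.

Theorem theorem7 (G : sgraph) :
  elc_preserved G -> elc_preserved (hamming_expansion G).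
Proof.
move=> elcG [i a] [j b] uv.
have [eij|ij] := eqVneq i j.
  by subst j; apply/isomorphic_sym/elc_within_block.
have eij : adj i j by move: uv; rewrite hamming_adj (negbTE ij) => /and3P[].
apply: isomorphic_trans (isomorphic_hamming (elcG _ _ eij)).
exact/isomorphic_sym/elc_between_blocks.
Qed.
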